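(* Let $G$ be a completely metrizable topological group with the virtual Rokhlin property, and let $H$ be a cm-slender group. Then every (abstract) group homomorphism $G\to H$ is trivial.
   Context: A topological group has the Rokhlin property if it contains an element whose conjugacy class is dense. It has the virtual Rokhlin property if it contains an open finite-index subgroup which, with the subspace topology, has the Rokhlin property. A group $H$ is cm-slender if, for every completely metrizable topological group $G$ and every abstract group homomorphism $\varphi\colon G\to H$, the kernel of $\varphi$ is open in $G$. *)

(* Defs.v *)
From HB Require Import structures.
From mathcomp Require Import all_boot all_order all_algebra.
From mathcomp Require Import all_classical all_reals all_analysis.

Set Implicit Arguments.
Unset Strict Implicit.
Unset Printing Implicit Defensive.

Import Order.TTheory GRing.Theory Num.Theory.
Import numFieldNormedType.Exports.

Local Open Scope classical_set_scope.
Local Open Scope group_scope.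

HB.mixin Record isTopologicalGroup G of Group G & Topological G := {
  mulg_continuous : continuous (fun x : G * G => x.1 * x.2) ;
  invg_continuous : continuous (fun x : G => x^-1)
}.

#[short(type="topologicalGroupType")]
HB.structure Definition TopologicalGroup :=
  {G of Group G & Topological G & isTopologicalGroup G}.

Definition subgroup_type (G : topologicalGroupType) (U : groupClosed G) : Type :=
  {x : G | x \in U}.

Section SubgroupTopologicalGroup.
Variables (G : topologicalGroupType) (U : groupClosed G).
Local Notation gU := (subgroup_type U).

HB.instance Definition _ := [isSub of gU for @sval G (fun x => x \in U)].
HB.instance Definition _ := [Choice of gU by <:].

Let group_closedU : group_closed U.
Proof.
split; first exact: gpred1.
by move=> x y xU yU; apply: gpredM => //; apply: gpredVr.
Qed.

HB.instance Definition _ :=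
  SubChoice_isSubGroup.Build G (fun x => x \in U) gU group_closedU.

HB.instance Definition _ :=
  Topological.copy gU (initial_topology (val : gU -> G)).

Let val_continuous : continuous (val : gU -> G).
Proof. exact: initial_continuous. Qed.

Let mulgU_continuous : continuous (fun x : gU * gU => x.1 * x.2).
Proof.
apply: (@continuous_comp_initial _ (gU * gU)%type G (val : gU -> G)).
have -> : (val : gU -> G) \o (fun x : gU * gU => x.1 * x.2) =
    (fun z : G * G => z.1 * z.2) \o (fun x : gU * gU => (val x.1, val x.2)).
  by apply/funext => x; exact: valM.
move=> x; apply: continuous_comp; last exact: mulg_continuous.
by apply: cvg_pair; apply: continuous_comp;
  [exact: cvg_fst|exact: val_continuous|exact: cvg_snd|exact: val_continuous].
Qed.

Let invgU_continuous : continuous (fun x : gU => x^-1).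
Proof.
apply: (@continuous_comp_initial _ gU G (val : gU -> G)).
have -> : (val : gU -> G) \o (fun x : gU => x^-1) =
    (fun z : G => z^-1) \o (val : gU -> G).
  by apply/funext => x; exact: (@gmulfV gU G val).
by move=> x; apply: continuous_comp; [exact: val_continuous|exact: invg_continuous].
Qed.

HB.instance Definition _ :=
  isTopologicalGroup.Build gU mulgU_continuous invgU_continuous.

End SubgroupTopologicalGroup.

(* The topology of [T] is the metric topology of some complete metric.  The
   fourth conjunct says that [d] induces the given topology of [T], so that
   convergence in the last one is convergence with respect to [d]. *)
Definition completely_metrizable (R : realType) (T : topologicalType) : Prop :=
  exists d : T -> T -> R,
    [/\ forall x y, (d x y = 0)%R <-> x = y,
        forall x y, d x y = d y x,
        forall x y z, (d x z <= d x y + d y z)%R,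
        forall x (A : set T),
          nbhs x A <-> exists2 e : R, (0 < e)%R & [set y | (d x y < e)%R] `<=` A
      & forall u : nat -> T,
          (forall e : R, (0 < e)%R ->
             exists N, forall m n, (N <= m)%N -> (N <= n)%N ->
               (d (u m) (u n) < e)%R) ->
          exists l : T, u @ \oo --> l].

Definition rokhlin (G : topologicalGroupType) : Prop :=
  exists x : G, dense (range (fun y : G => x ^ y)).

Definition finite_index (G : groupType) (U : set G) : Prop :=
  finite_set (range (fun x : G => (fun u => x * u) @` U)).

Definition virtually_rokhlin (G : topologicalGroupType) : Prop :=
  exists U : groupClosed G,
    [/\ open [set` U], finite_index [set` U] & rokhlin (subgroup_type U)].

Definition cm_slender (R : realType) (H : groupType) : Prop :=
  forall (G : topologicalGroupType) (phi : UMagmaMorphism.type G H),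
    completely_metrizable R G -> open (phi @^-1` [set 1]).

(* Main.v *)
(** The kernel of [phi] is open, so in the open finite-index subgroup [U] a dense
    conjugacy class meets both the kernel and every coset of it; hence [phi] kills
    [U] and every value of [phi] has finite order. A cm-slender group is
    torsion-free: if [h ^+ n = 1], send a sequence in the product of countably many
    copies of [Z/n] to its limit [k] along a nonprincipal ultrafilter and then to
    [h ^+ k]. The kernel is open, hence contains all sequences vanishing on some
    initial segment, and one of these is eventually [1], with value [h]. *)
Require Import Defs.
From HB Require Import structures.
From mathcomp Require Import all_boot all_order all_fingroup all_algebra.
From mathcomp Require Import all_classical all_reals all_analysis.

Set Implicit Arguments.
Unset Strict Implicit.
Unset Printing Implicit Defensive.

Import Order.TTheory GRing.Theory Num.Theory.

Local Open Scope classical_set_scope.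
Local Open Scope group_scope.

(* An alias of [nat -> A], to be topologized as a product of discrete groups
   whatever the topology of [A]. *)
Definition seq_group (A : groupType) : Type := nat -> A.

Section SeqGroup.
Variable A : groupType.
Local Notation S := (seq_group A).

HB.instance Definition _ := gen_eqMixin S.
HB.instance Definition _ := gen_choiceMixin S.

Let mul (x y : S) : S := fun n => x n * y n.
Let inv (x : S) : S := fun n => (x n)^-1.
Let one : S := fun=> 1.

Let mulA : associative mul.
Proof. by move=> x y z; apply/funext => n; exact: mulgA. Qed.
Let mul1 : left_id one mul.
Proof. by move=> x; apply/funext => n; exact: mul1g. Qed.
Let mulr1 : right_id one mul.
Proof. by move=> x; apply/funext => n; exact: mulg1. Qed.
Let mulV : left_inverse one inv mul.
Proof. by move=> x; apply/funext => n; exact: mulVg. Qed.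
Let mulrV : right_inverse one inv mul.
Proof. by move=> x; apply/funext => n; exact: mulgV. Qed.

HB.instance Definition _ := isGroup.Build S mulA mul1 mulr1 mulV mulrV.

Definition agree (n : nat) (x y : S) := forall i, (i < n)%N -> x i = y i.

Lemma agree_sym n x y : agree n x y -> agree n y x.
Proof. by move=> xy i /xy. Qed.

Lemma agree_trans n x y z : agree n x y -> agree n y z -> agree n x z.
Proof. by move=> xy yz i ni; rewrite xy// yz. Qed.

Lemma agreeW m n x y : (m <= n)%N -> agree n x y -> agree m x y.
Proof. by move=> mn xy i im; apply: xy; exact: leq_trans mn. Qed.

(** Cylinders over initial segments form a neighbourhood base of the product of discrete spaces. *)
HB.instance Definition _ := hasNbhs.Build S
  (fun x => [set B | exists n, [set y | agree n x y] `<=` B]).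

Lemma nbhs_seqE (x : S) (B : set S) :
  nbhs x B = exists n, [set y | agree n x y] `<=` B.
Proof. by []. Qed.

Let seq_nbhs_filter (x : S) : ProperFilter (nbhs x).
Proof.
split; first by move=> [n /(_ x)]; apply.
split; first by exists 0%N.
- move=> B C [m mB] [n nC]; exists (maxn m n) => y xy.
  by split; [apply: mB|apply: nC]; apply: agreeW xy; rewrite ?leq_maxl ?leq_maxr.
- by move=> B C BC [n nB]; exists n => y /nB/BC.
Qed.

Let seq_nbhs_singleton (x : S) (B : set S) : nbhs x B -> B x.
Proof. by move=> [n]; apply. Qed.

Let seq_nbhs_nbhs (x : S) (B : set S) : nbhs x B -> nbhs x (nbhs^~ B).
Proof.
by move=> [n nB]; exists n => y xy; exists n => z yz; apply/nB/(agree_trans xy yz).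
Qed.

HB.instance Definition _ := Nbhs_isNbhsTopological.Build S
  seq_nbhs_filter seq_nbhs_singleton seq_nbhs_nbhs.

Let mul_continuous : continuous (fun x : S * S => x.1 * x.2).
Proof.
move=> [x y] B [n nB].
exists ([set z | agree n x z], [set z | agree n y z]); first by split; exists n.
by move=> [z t] [/= xz yt]; apply: nB => i ni /=; congr (_ * _); [exact: xz|exact: yt].
Qed.

Let inv_continuous : continuous (fun x : S => x^-1).
Proof.
move=> x B [n nB]; exists n => y xy; apply: nB => i ni.
by congr (_^-1); exact: xy.
Qed.

HB.instance Definition _ :=
  isTopologicalGroup.Build S mul_continuous inv_continuous.

Section Distance.
Variable R : realType.
Local Open Scope ring_scope.

Definition seq_dist (x y : S) : R :=
  if pselect (exists n, x n != y n) is left h then (ex_minn h).+1%:R^-1 else 0.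

(** If [m] is the first index of disagreement, [1/(m+1) < 1/(n+1)] means [n < m], hence agreement up
    to and including [n]. This turns balls into cylinders. *)
Lemma seq_dist_lt (x y : S) n : seq_dist x y < n.+1%:R^-1 <-> agree n.+1 x y.
Proof.
rewrite /seq_dist; case: pselect => [h|h]; last first.
  split=> _; last by rewrite invr_gt0 ltr0n.
  by move=> i _; apply/eqP/negPn/negP => xy; apply: h; exists i.
case: ex_minnP => m xym mP; rewrite ltf_pV2 ?posrE ?ltr0n// ltr_nat ltnS.
split=> [nm i ni|xy]; last by rewrite ltnNge; apply/negP => mn; rewrite xy// eqxx in xym.
by apply/eqP/negPn/negP => /mP; rewrite leqNgt (leq_ltn_trans _ nm).
Qed.

Lemma seq_dist_ge0 (x y : S) : 0 <= seq_dist x y.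
Proof. by rewrite /seq_dist; case: pselect => // h; rewrite invr_ge0. Qed.

(** A nonzero distance is itself a radius of the form handled by [seq_dist_lt]. *)
Variant seq_dist_spec (x y : S) : R -> Prop :=
| SeqDist0 of x = y : seq_dist_spec x y 0
| SeqDistV n of x <> y : seq_dist_spec x y n.+1%:R^-1.

Lemma seq_distP (x y : S) : seq_dist_spec x y (seq_dist x y).
Proof.
rewrite /seq_dist; case: pselect => [h|h]; constructor.
  by move=> xy; case: h => n; rewrite xy eqxx.
by apply/funext => n; apply/eqP/negPn/negP => xy; apply: h; exists n.
Qed.

(** Take the distance from [x] to [z] as radius: were both others smaller, transitivity of [agree]
    would make it smaller than itself. *)
Lemma seq_dist_ultra (x y z : S) :
  seq_dist x z <= Num.max (seq_dist x y) (seq_dist y z).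
Proof.
rewrite leNgt gt_max; apply/negP => /andP[].
case exz: _ / (seq_distP x z) => [_|n _]; first by rewrite ltNge seq_dist_ge0.
move=> /seq_dist_lt xy /seq_dist_lt yz.
by have /seq_dist_lt := agree_trans xy yz; rewrite exz ltxx.
Qed.

Lemma seq_group_completely_metrizable : completely_metrizable R S.
Proof.
exists seq_dist; split.
- move=> x y; case: seq_distP => [|n] xy; split=> // /eqP.
  by rewrite invr_eq0 pnatr_eq0.
- suff le x y : seq_dist x y <= seq_dist y x.
    by move=> x y; apply/le_anti; rewrite !le.
  rewrite leNgt; apply/negP.
  case exy: _ / (seq_distP x y) => [_|n _]; first by rewrite ltNge seq_dist_ge0.
  by move=> /seq_dist_lt/agree_sym/seq_dist_lt; rewrite exy ltxx.
- move=> x y z; apply: le_trans (seq_dist_ultra x y z) _.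
  by rewrite ge_max lerDl lerDr !seq_dist_ge0.
- move=> x B; rewrite nbhs_seqE; split=> [[n nB]|[e e0 eB]].
    exists n.+1%:R^-1; first by rewrite invr_gt0 ltr0n.
    by move=> y /seq_dist_lt xy; apply: nB; exact: agreeW xy.
  have [n ne] : exists n, n.+1%:R^-1 < e.
    have [n _ nP] := near_infty_natSinv_lt (PosNum e0).
    by exists n; exact: nP (leqnn n).
  by exists n.+1 => y /seq_dist_lt xy; apply: eB; exact: lt_trans ne.
- move=> u uC.
  have {uC} /choice[N NP] n : exists N, forall p q, (N <= p)%N -> (N <= q)%N ->
      agree n.+1 (u p) (u q).
    have [|N NP] := uC n.+1%:R^-1; first by rewrite invr_gt0 ltr0n.
    by exists N => p q Np Nq; apply/seq_dist_lt/NP.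
  (* From rank [N k] on, coordinate [k] of the sequence is constant; the limit collects these stable
     values. *)
  exists (fun k => u (N k) k) => B [n nB].
  exists (N n) => // m /= Nm; apply: nB => i ni.
  (* A rank beyond both [N n] and [N i] links the limit value at [i] with [u m i]. *)
  rewrite (NP i (N i) (maxn (N n) (N i)))// ?leq_maxr//.
  by apply: (NP n) => //; rewrite ?leq_maxl// ltnW.
Qed.

End Distance.
End SeqGroup.

Section Ultralimit.
Variables (A : finGroupType) (F : set_system nat).
Hypothesis FU : UltraFilter F.

(** Otherwise the ultrafilter contains the complement of every fiber of [x], hence, [A] being
    finite, their empty intersection. *)
Lemma ultralimit_exists (x : nat -> A) : exists a, F [set n | x n = a].
Proof.
apply: contrapT => /forallNP nF.
have /filter_ex[n /(_ (x n))] : \forall n \near F, forall a, x n <> a; last exact.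
apply: filter_forall => a.
by have [|] := @in_ultra_setVsetC _ F [set n | x n = a] FU => // /nF.
Qed.

Definition ultralimit (x : seq_group A) : A := projT1 (cid (ultralimit_exists x)).

Lemma ultralimitP x : F [set n | x n = ultralimit x].
Proof. by rewrite /ultralimit; case: cid. Qed.

Lemma ultralimitE (x : seq_group A) a : F [set n | x n = a] -> ultralimit x = a.
Proof. by move=> /(filterI (ultralimitP x))/filter_ex[n [/= <-]]. Qed.

Lemma ultralimitM : {morph ultralimit : x y / x * y}.
Proof.
move=> x y; apply: ultralimitE.
by apply: filterS2 (ultralimitP x) (ultralimitP y) => n /= xa yb; rewrite -xa -yb.
Qed.

End Ultralimit.

Lemma cm_slender_torsion_free (R : realType) (H : groupType) (h : H) (n : nat) :
  cm_slender R H -> h ^+ n.+1 = 1 -> h = 1.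
Proof.
move=> csH hn.
(* The group law of ['I_n.+1] is addition modulo [n.+1]; this makes [k] to [h ^+ k] a homomorphism
   on it. *)
have hmod k : h ^+ (k %% n.+1) = h ^+ k.
  by rewrite [in RHS](divn_eq k n.+1) expgnDr mulnC expgnA hn expg1n mul1g.
have [F [FU ooF]] := @ultraFilterLemma nat \oo _.
pose f (x : seq_group 'I_n.+1) : H := h ^+ (ultralimit FU x : nat).
have fM : monoid.monoid_morphism f.
  split=> [|x y].
    by rewrite /f (@ultralimitE _ _ _ _ 1)// (_ : [set _ | _] = setT);
      [exact: filterT|apply/seteqP].
  by rewrite /f ultralimitM hmod expgnDr.
pose fH := isUMagmaMorphism.Build _ _ f fM.
pose g : UMagmaMorphism.type (seq_group 'I_n.+1) H := HB.pack f fH.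
have := csH _ g (@seq_group_completely_metrizable _ R).
rewrite openE => /(_ 1 gmulf1)[N NP].
(* The first [1] is the neutral element, residue 0, whereas [inZp 1] is the residue of the number
   1. *)
pose x : seq_group 'I_n.+1 := fun i => if (i < N)%N then 1 else inZp 1.
have <- : g x = h.
  rewrite /g/= /f (@ultralimitE _ _ _ _ (inZp 1)) ?hmod//.
  by apply: ooF; exists N => // i /= Ni; rewrite /x ltnNge Ni.
by apply: NP => i iN; rewrite /x iN.
Qed.

Section OpenKernel.
Variables (G : topologicalGroupType) (H : groupType).
Variables (phi : UMagmaMorphism.type G H) (oK : open (phi @^-1` [set 1])).

(** The fiber is the left translate by [a] of the open kernel. *)
Lemma open_fiber (a : G) : open (phi @^-1` [set phi a]).
Proof.
have -> : phi @^-1` [set phi a] = (fun z => a^-1 * z) @^-1` (phi @^-1` [set 1]).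
  apply/seteqP; split=> z /=; rewrite gmulfM gmulfV; first by move=> ->; rewrite mulVg.
  by move=> /(canRL (mulKVg _)); rewrite mulg1.
apply: open_comp => // z _.
apply: (@continuous_comp _ _ _ (fun z => (a^-1, z)) (fun z : G * G => z.1 * z.2)).
  by apply: cvg_pair; [exact: cvg_cst|exact: cvg_id].
exact: mulg_continuous.
Qed.

Lemma rokhlin_subgroup_ker (U : groupClosed G) :
  rokhlin (subgroup_type U) -> forall u, u \in U -> phi u = 1.
Proof.
move=> [x xD] u uU.
have fiber (v : subgroup_type U) : exists y, phi (val (x ^ y)) = phi (val v).
  have [||w [/= wv [y _ yw]]] := xD (val @^-1` (phi @^-1` [set phi (val v)])).
  - by exists v.
  - by apply: open_comp (open_fiber _) => z _; exact: initial_continuous.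
  - by exists y; exact: etrans (congr1 (phi \o val) yw) wv.
have phix y : phi (val (x ^ y)) = phi (val x) ^ phi (val y).
  by rewrite !gmulfJ.
(* Meeting the kernel makes a conjugate of [phi (val x)] trivial, so [phi] is trivial on the whole
   class; meeting the fiber of [u] then gives [phi u = 1]. *)
have [y] := fiber 1; rewrite phix !gmulf1 => /eqP; rewrite conjg_eq1 => /eqP x1.
by have [z] := fiber (exist _ u uU); rewrite phix x1 conj1g => ->.
Qed.

End OpenKernel.

(** Pigeonhole: the cosets of the powers of [x] cannot be pairwise distinct. *)
Lemma finite_index_expg (G : groupType) (U : set G) (x : G) : U 1 ->
  finite_index U -> exists i j (u : G), [/\ (i < j)%N, U u & x ^+ j = x ^+ i * u].
Proof.
move=> U1 fU; apply: contrapT => nex; apply: infinite_nat.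
pose c (y : G) := (fun u => y * u) @` U.
have cI : injective (fun i => c (x ^+ i)).
  suff lt i j : (i < j)%N -> c (x ^+ i) <> c (x ^+ j).
    by move=> i j cij; have [/lt|/lt/(_ (esym cij))|] := ltngtP i j.
  move=> ij cij; apply: nex; have : c (x ^+ j) (x ^+ j) by exists 1; rewrite ?mulg1.
  by rewrite -cij => -[u Uu xu]; exists i, j, u.
have := finite_preimage (in2W cI) fU.
by congr finite_set; apply/seteqP; split=> // i _; exists (x ^+ i).
Qed.

Theorem proposition1p10 (R : realType) (G : topologicalGroupType)
    (H : groupType)
    (cmG : completely_metrizable R G) (vrG : virtually_rokhlin G)
    (csH : cm_slender R H)
    (phi : UMagmaMorphism.type G H) :
  forall x : G, phi x = 1.
Proof.
move=> x; have [U [_ fU rU]] := vrG.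
have phiU := rokhlin_subgroup_ker (csH G phi cmG) rU.
have [|i [j [u [ij Uu xji]]]] := finite_index_expg x _ fU; first exact: gpred1.
(* Since [phi u = 1], the powers [i] and [j] of [phi x] coincide; the predecessor fits the exponent
   [n.+1] of the torsion lemma. *)
apply: (@cm_slender_torsion_free R H _ (j - i).-1 csH).
rewrite prednK ?subn_gt0// expgnFr 1?ltnW// -!gmulfXn xji gmulfM (phiU u)//.
by rewrite mulg1 mulgV.
Qed.
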